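(* Let $F$ and $G$ be abelian groups, let $\varnothing\neq\Psi\subseteq\operatorname{Hom}(F,G)\setminus\{\mathbf 0\}$, and let $n\ge 1$ be an integer. Then the following two statements are equivalent. (i) ${\rm D}_{\Psi}(G)\le n$. (ii) The group $F^n$ is covered by the kernels of the nonzero universal homomorphisms induced by the tuples in $(\Psi\cup\{\mathbf 0\})^n$; more precisely, $$F^n=\bigcup_{\boldsymbol{\eta}\in (\Psi\cup\{\mathbf 0\})^n\setminus\{(\mathbf 0,\ldots,\mathbf 0)\}} \ker\bigl(\operatorname{ind}[\boldsymbol{\eta}]\bigr).$$ Consequently, $$ {\rm D}_{\Psi}(G) = \min\left\{ n\in\mathbb N: F^n = \bigcup_{\boldsymbol{\eta}\in (\Psi\cup\{\mathbf 0\})^n\setminus \{(\mathbf 0,\ldots,\mathbf 0)\}} \ker\bigl(\operatorname{ind}[\boldsymbol{\eta}]\bigr) \right\},$$ where the minimum of the empty set is understood to be $\infty$.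
   Context: Groups may be infinite. $\operatorname{Hom}(F,G)$ is the group of all homomorphisms $F\to G$, and $\mathbf 0$ is the zero homomorphism. $\mathbb N$ denotes the positive integers. For $\boldsymbol{\eta}=(\psi_1,\ldots,\psi_n)\in\operatorname{Hom}(F,G)^n$, the induced universal homomorphism $\operatorname{ind}[\boldsymbol{\eta}]:F^n\to G$ is given by $\operatorname{ind}[\boldsymbol{\eta}](x_1,\ldots,x_n)=\sum_{i=1}^n\psi_i(x_i)$. A sequence over $F$ is a finite unordered sequence (multiset) of elements of $F$, repetition allowed; its length is the number of terms counted with multiplicity, and subsequences are sub-multisets. For a nonempty subset $\Psi\subseteq\operatorname{Hom}(F,G)$, the $\Psi$-weighted Davenport constant ${\rm D}_\Psi(G)$ is the least positive integer $\ell$ such that every sequence $T$ over $F$ of length $\ell$ has a nonempty subsequence $a_1\cdot\ldots\cdot a_k$ ($k>0$) with $\sum_{i=1}^k\psi_i(a_i)=0_G$ for some (not necessarily distinct) $\psi_1,\ldots,\psi_k\in\Psi$; if no such $\ell$ exists, ${\rm D}_\Psi(G)=\infty$. *)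

(* Defs.v *)
From HB Require Import structures.
From mathcomp Require Import all_boot all_order all_algebra.
From mathcomp Require Import finmap multiset.
From mathcomp Require Import boolp classical_sets.
Set Implicit Arguments.
Unset Strict Implicit.
Unset Printing Implicit Defensive.
Import GRing.Theory.
Local Open Scope ring_scope.
Local Open Scope classical_set_scope.

(* Elements of [option nat] are extended natural numbers, [None] being oo. *)
Definition le_natinf (x y : option nat) : bool :=
  match x, y with
  | _, None => true
  | None, Some _ => false
  | Some m, Some n => (m <= n)%N
  end.

(* Minimum of a set of natural numbers, with min(empty set) = oo. *)
Definition min_natinf (A : set nat) : option nat :=
  match pselect (exists n, `[< A n >]) with
  | left exA => Some (ex_minn exA)
  | right _ => None
  end.

Definition ker (U V : zmodType) (f : {additive U -> V}) : set U :=
  [set x | f x = 0].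

Definition set_power (T : Type) (A : set T) (n : nat) : set {ffun 'I_n -> T} :=
  [set f | forall i, A (f i)].
Arguments set_power {T} A n.

Section WeightedDavenport.
Variables F G : zmodType.

(* [{additive F -> G}] has no zmodType instance in the library, so its zero
   element is named here. *)
Definition hom0 : {additive F -> G} := \0.

Section Ind.
Variables (n : nat) (eta : {ffun 'I_n -> {additive F -> G}}).

Definition ind (x : {ffun 'I_n -> F}) : G := \sum_(i < n) eta i (x i).

Fact ind_is_additive : zmod_morphism ind.
Proof.
move=> x y; rewrite /ind -sumrB.
by apply: eq_bigr => i _; rewrite !ffunE raddfB.
Qed.

HB.instance Definition _ :=
  GRing.isZmodMorphism.Build {ffun 'I_n -> F} G ind ind_is_additive.
End Ind.

(* The weights are attached to the terms of an enumeration a_1, ..., a_k of the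
   subsequence, so that equal terms may receive different weights. *)
Definition has_weighted_zero_sum
    (Psi : set {additive F -> G}) (T : {mset F}%mset) : Prop :=
  exists (k : nat) (a : k.-tuple F) (psi : 'I_k -> {additive F -> G}),
    [/\ (0 < k)%N, (seq_mset a `<=` T)%mset, forall i, Psi (psi i)
      & \sum_(i < k) psi i (tnth a i) = 0].

Definition davenport (Psi : set {additive F -> G}) : option nat :=
  min_natinf [set l : nat | (0 < l)%N /\
    forall T : {mset F}%mset, size T = l -> has_weighted_zero_sum Psi T].

Definition weight_tuples (Psi : set {additive F -> G}) (n : nat) :
    set {ffun 'I_n -> {additive F -> G}} :=
  set_power (Psi `|` [set hom0]) n `\ [ffun=> hom0].

End WeightedDavenport.
Arguments weight_tuples {F G} Psi n.

(* Main.v *)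
(* Choosing a nonempty subsequence of a sequence of length n with weights in Psi
   amounts to weighting all n terms by Psi together with 0, not all weights
   being 0: the weight 0, which is not in Psi, marks the discarded terms.  So the
   sequence has a weighted zero-sum subsequence iff it is, in any order, a point
   of F^n in one of the kernels.  This settles each fixed length n; minima over
   n then agree, and having the zero-sum property is monotone in n. *)
Require Import Defs.
From mathcomp Require Import all_boot all_order all_algebra.
From mathcomp Require Import finmap multiset.
From mathcomp Require Import boolp classical_sets.
From mathcomp Require Import perm.
Import GRing.Theory.
Local Open Scope ring_scope.
Local Open Scope classical_set_scope.

Lemma le_min_natinf (A : set nat) (n : nat) :
  le_natinf (min_natinf A) (Some n) <-> exists2 m, A m & (m <= n)%N.
Proof.
rewrite /min_natinf; case: pselect => [exA|nexA] /=.
  case: ex_minnP => m /asboolP Am min_m; split; first by exists m.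
  by case=> k Ak; apply: leq_trans; apply/min_m/asboolP.
by split=> // -[m Am _]; case: nexA; exists m; apply/asboolP.
Qed.

(** The complement [b] makes the discarded terms explicit, so that all terms of [s] can be listed
    with the chosen ones first. *)
Lemma msubset_seq_mset_perm (K : choiceType) (a s : seq K) :
  (seq_mset a `<=` seq_mset s)%mset <-> exists b, perm_eq (a ++ b) s.
Proof.
split=> [/msubsetP ltas | [b /seq.permP eq_s]].
  have /count_subseqP[a' /perm_to_subseq[b eq_s] eq_a] y :
    (count_mem y a <= count_mem y s)%N by rewrite -!mset_seqE.
  by exists b; rewrite perm_sym (perm_trans eq_s)// perm_cat2r perm_sym.
by apply/msubsetP=> y; rewrite !mset_seqE -eq_s count_cat leq_addr.
Qed.

Section ZeroSums.
Context {F G : zmodType} (Psi : set {additive F -> G}).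

Lemma has_weighted_zero_sumW (S T : {mset F}%mset) :
  (S `<=` T)%mset -> has_weighted_zero_sum Psi S -> has_weighted_zero_sum Psi T.
Proof.
move=> leST [k [a [psi [k_gt0 leaS Ppsi sum0]]]].
by exists k, a, psi; split=> //; apply: msubset_trans leaS leST.
Qed.

Lemma weight_tuple_zero_sum (n : nat) (x : {ffun 'I_n -> F}) eta :
    weight_tuples Psi n eta -> ind eta x = 0 ->
  has_weighted_zero_sum Psi (seq_mset [tuple x i | i < n]).
Proof.
move=> [Peta eta_neq0] sum0.
(* [D] holds the positions of the kept terms. It is nonempty because [eta] is not the zero tuple. *)
pose D := [pred i | `[< eta i <> hom0 F G >]].
have D_gt0 : (0 < #|D|)%N.
  apply/card_gt0P; apply: contrapT => noD; apply: eta_neq0.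
  apply/ffunP=> i; rewrite ffunE; apply: contrapT => etai.
  by apply: noD; exists i; apply/asboolP.
exists #|D|, [tuple x (enum_val j) | j < #|D|], (fun j => eta (enum_val j)).
split=> //.
(* Enumerating [D] filters the enumeration of ['I_n], so the kept terms form a subsequence of the
   values of [x]. *)
- have -> : tval [tuple x (enum_val j) | j < #|D|] = [seq x i | i in D].
    apply: (@eq_from_nth _ 0) => [|j]; first by rewrite size_tuple size_image.
    rewrite size_tuple => ltj; rewrite -[j]/(val (Ordinal ltj)).
    by rewrite -tnth_nth tnth_mktuple nth_image.
  apply/msubsetP => y; rewrite !mset_seqE /= leq_count_subseq //.
  apply/map_subseq; rewrite enumT [in X in subseq X _]/enum_mem.
  exact: filter_subseq.
- move=> j; case: (Peta (enum_val j)) => //= eta0.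
  by have /asboolP := enum_valP j.
under eq_bigr do rewrite tnth_mktuple.
rewrite -(big_enum_val (fun i => eta i (x i))) -[RHS]sum0 /ind.
rewrite [RHS](bigID D) /= [X in _ = _ + X]big1 ?addr0 // => i.
by move=> /asboolPn/contrapT->.
Qed.

Lemma zero_sum_weight_tuple (n : nat) (x : {ffun 'I_n -> F}) :
    Psi `<=` ~` [set hom0 F G] ->
    has_weighted_zero_sum Psi (seq_mset [tuple x i | i < n]) ->
  exists2 eta, weight_tuples Psi n eta & ind eta x = 0.
Proof.
move=> Psi_sub [k [a [psi [k_gt0 /msubset_seq_mset_perm[b eq_ab] Ppsi sum0]]]].
have size_ab : (k + size b)%N = n.
  by have := perm_size eq_ab; rewrite size_cat !size_tuple.
have /tuple_permP[p def_ab] := eq_ab.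
(* Weights by position in [a ++ b]: [psi] on the first [k] positions, zero on those of [b]. Since
   position [j] holds [x (p j)], the tuple sought is [e] composed with the inverse of [p]. *)
pose e j := if insub j is Some j' then psi j' else hom0 F G.
have xpE (j : 'I_n) : x (p j) = nth 0 (a ++ b) j.
  by rewrite def_ab -tnth_nth !tnth_mktuple.
have n_gt0 : (0 < n)%N by rewrite -size_ab addn_gt0 k_gt0.
exists [ffun i => e ((p^-1)%g i : nat)].
  split=> [i|].
    by rewrite ffunE /e; case: insub => [j|]; [left|right].
  (* As [k > 0], position 0 lies in [a], so its weight is in [Psi] and cannot be zero. *)
  move/ffunP/(_ (p (Ordinal n_gt0))); rewrite !ffunE permK /e insubT /=.
  by apply: Psi_sub; apply: Ppsi.
rewrite /ind (reindex_inj (@perm_inj _ p)) /=.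
under eq_bigr do rewrite ffunE permK xpE.
rewrite -(big_mkord xpredT (fun j => e j (nth 0 (a ++ b) j))).
rewrite (@big_cat_nat _ _ _ k) //=; last by rewrite -size_ab leq_addr.
rewrite [X in _ + X]big_nat_cond [X in _ + X]big1 ?addr0.
  rewrite big_mkord -[RHS]sum0; apply: eq_bigr => j _.
  by rewrite /e valK nth_cat size_tuple ltn_ord -tnth_nth.
by move=> j /andP[/andP[lekj _] _]; rewrite /e insubF // ltnNge lekj.
Qed.

Lemma zero_sums_iff_cover (n : nat) : Psi `<=` ~` [set hom0 F G] ->
  (forall T : {mset F}%mset, size T = n -> has_weighted_zero_sum Psi T) <->
  [set: {ffun 'I_n -> F}] = \bigcup_(eta in weight_tuples Psi n) ker (ind eta).
Proof.
move=> Psi_sub; split=> [zsT | cover T sizeT].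
  apply/esym/seteqP; split=> // x _.
  have [|eta ? ?] := zero_sum_weight_tuple n x Psi_sub; last by exists eta.
  by apply: zsT; rewrite (perm_size (perm_eq_seq_mset _)) size_tuple.
(* The point of [F^n] comes from the canonical enumeration of [T]; the default 0 is never reached
   since [T] has size [n]. *)
have [eta Peta kereta] :
    (\bigcup_(eta in weight_tuples Psi n) ker (ind eta))
      [ffun i : 'I_n => nth 0 T i] by rewrite -cover.
have := weight_tuple_zero_sum _ _ _ Peta kereta; congr has_weighted_zero_sum.
rewrite -[RHS]seq_mset_id; congr seq_mset.
apply: (@eq_from_nth _ 0) => [|j]; rewrite size_tuple // => ltj.
by rewrite -[j]/(val (Ordinal ltj)) -tnth_nth tnth_mktuple ffunE.
Qed.

(** Any [m] terms of [T] already contain a weighted zero-sum subsequence; the first [m] are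
    taken. *)
Lemma zero_sums_monotone (m n : nat) : (m <= n)%N ->
  (forall T : {mset F}%mset, size T = m -> has_weighted_zero_sum Psi T) ->
  forall T : {mset F}%mset, size T = n -> has_weighted_zero_sum Psi T.
Proof.
move=> lemn zsm T sizeT; apply: (has_weighted_zero_sumW (seq_mset (take m T))).
  rewrite -[X in (_ `<=` X)%mset]seq_mset_id; apply/msubset_seq_mset_perm.
  by exists (drop m T); rewrite cat_take_drop.
apply: zsm; rewrite (perm_size (perm_eq_seq_mset _)) size_takel //.
by rewrite sizeT.
Qed.

End ZeroSums.

Theorem theorem4p1 (F G : zmodType) (Psi : set {additive F -> G})
    (Psi_neq0 : Psi !=set0) (Psi_sub : Psi `<=` ~` [set hom0 F G]) :
  (forall n : nat, (1 <= n)%N ->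
     (le_natinf (davenport Psi) (Some n) <->
      [set: {ffun 'I_n -> F}] =
        \bigcup_(eta in weight_tuples Psi n) ker (ind eta))) /\
  davenport Psi =
    min_natinf [set n : nat | (0 < n)%N /\
      [set: {ffun 'I_n -> F}] =
        \bigcup_(eta in weight_tuples Psi n) ker (ind eta)].
Proof.
split=> [n n_gt0|].
  (* The bound on the minimum only yields some good length [m <= n]; monotonicity carries it up to
     [n]. *)
  rewrite -zero_sums_iff_cover // le_min_natinf; split=> [[m [_ zsm] lemn]|zsn].
    exact: zero_sums_monotone zsm.
  by exists n.
congr min_natinf; apply/seteqP.
by split=> n [n_gt0 zsn]; split=> //; apply/zero_sums_iff_cover.
Qed.
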